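(* Let $D_{1,+},D_{1,-}$ form a periodic first-derivative upwind SBP operator on a grid with $N$ nodes with diagonal mass matrix $M$. Let $g>0$, let $\boldsymbol D=(D(x_1),\dots,D(x_N))^T\in\mathbb R^N$ be the vector of still water depths at the grid nodes, and let $K=\operatorname{diag}(\boldsymbol D^2)$. Consider the system of ordinary differential equations for $\boldsymbol\eta(t),\boldsymbol v(t)\in\mathbb R^N$ $$\boldsymbol\eta_t+\Big(I-\tfrac16 D_{1,-}KD_{1,+}\Big)^{-1}D_{1,-}(\boldsymbol D\boldsymbol v+\boldsymbol\eta\boldsymbol v)=\boldsymbol 0,\qquad \boldsymbol v_t+\Big(I-\tfrac16 D_{1,+}D_{1,-}K\Big)^{-1}D_{1,+}\Big(g\boldsymbol\eta+\tfrac12\boldsymbol v^2\Big)=\boldsymbol 0.$$ Then the system conserves the linear invariants $\mathcal M(t)=\boldsymbol 1^TM\boldsymbol\eta$ and $\mathcal V(t)=\boldsymbol 1^TM\boldsymbol v$ and the total energy $\mathcal E(t)=\boldsymbol 1^TM\big(\tfrac12 g\boldsymbol\eta^2+\tfrac12(\boldsymbol\eta+\boldsymbol D)\boldsymbol v^2\big)$, i.e. $\frac{d}{dt}\mathcal M=\frac{d}{dt}\mathcal V=\frac{d}{dt}\mathcal E=0$ along every solution. Furthermore, the scheme is well-balanced: every lake-at-rest state $\boldsymbol v=\boldsymbol 0$, $\boldsymbol\eta=c\,\boldsymbol 1$ with $c\in\mathbb R$ is a stationary solution.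
   Context: Products and powers of vectors in $\mathbb R^N$ are taken componentwise: $(\boldsymbol u\boldsymbol v)_j=u_jv_j$, $(\boldsymbol u^k)_j=u_j^k$. $\boldsymbol 1=(1,\dots,1)^T$, $\boldsymbol 0=(0,\dots,0)^T$, $I$ is the identity matrix. A derivative matrix $A\in\mathbb R^{N\times N}$ is consistent if $A\boldsymbol 1=\boldsymbol 0$. A periodic first-derivative upwind SBP (summation-by-parts) operator consists of a grid $\boldsymbol x$, consistent first-derivative matrices $D_{1,\pm}$ and a symmetric positive-definite matrix $M$ such that $MD_{1,+}+D_{1,-}^TM=0$ and $\frac12M(D_{1,+}-D_{1,-})$ is negative semidefinite. Throughout, $M$ is diagonal. The system is a semidiscretization (discrete in space, continuous in time) of the BBM-BBM equations with variable bathymetry $\eta_t+((\eta+D)v)_x-\frac16(D^2\eta_{xt})_x=0$, $v_t+g\eta_x+vv_x-\frac16(D^2v_t)_{xx}=0$ with periodic boundary conditions, where $\eta$ is the total water height, $v$ the velocity, $D$ the still water depth. *)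

(* Defs.v *)
From HB Require Import structures.
From mathcomp Require Import all_boot all_order all_algebra.
From mathcomp Require Import all_classical all_reals all_analysis.
Set Implicit Arguments.
Unset Strict Implicit.
Unset Printing Implicit Defensive.
Import Order.TTheory GRing.Theory Num.Theory.
Import numFieldNormedType.Exports.
Local Open Scope classical_set_scope.
Local Open Scope ring_scope.


Notation "u ⊙ v" := (map2_mx *%R u v) (at level 40, left associativity)
  : ring_scope.
Notation vsqr u := (map_mx (fun a => a ^+ 2) u).

Section Defs.
Variables (R : realType) (N : nat).
Implicit Types (A M : 'M[R]_N) (u v w : 'cV[R]_N).

(* The value is the 1 x 1 matrix u^T A v read as a scalar. *)
Definition bilin u A v : R := (u^T *m A *m v) 0 0.

Definition vone : 'cV[R]_N := const_mx 1.

Definition consistent A : Prop := A *m vone = 0.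

Definition sym_posdef A : Prop :=
  A^T = A /\ forall u, u != 0 -> 0 < bilin u A u.

Definition neg_semidef A : Prop :=
  A^T = A /\ forall u, bilin u A u <= 0.

Record periodic_upwind_sbp := PeriodicUpwindSBP {
  grid : 'cV[R]_N;
  Dp : 'M[R]_N;
  Dm : 'M[R]_N;
  mass : 'M[R]_N;
  Dp_consistent : consistent Dp;
  Dm_consistent : consistent Dm;
  mass_posdef : sym_posdef mass;
  sbp_property : mass *m Dp + Dm^T *m mass = 0;
  upwind_property : neg_semidef (2^-1 *: (mass *m (Dp - Dm)))
}.

Section Scheme.
Variables (S : periodic_upwind_sbp) (g : R) (depth : R -> R).

Definition depth_vec : 'cV[R]_N := \col_j depth (grid S j 0).

Definition Kmat : 'M[R]_N := diag_mx (vsqr depth_vec)^T.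

(* Both matrices below are invertible when the mass matrix is diagonal
   (eta_op_unit and v_op_unit), so invmx is applied to units only. *)
Definition eta_op : 'M[R]_N := 1%:M - 6^-1 *: (Dm S *m Kmat *m Dp S).
Definition v_op : 'M[R]_N := 1%:M - 6^-1 *: (Dp S *m Dm S *m Kmat).

Definition bbm_bbm_solution_at (eta v : R -> 'cV[R]_N) (t : R) : Prop :=
  [/\ derivable eta t 1,
      derivable v t 1,
      derive1 eta t
        + invmx eta_op *m Dm S *m (depth_vec ⊙ v t + eta t ⊙ v t) = 0
    & derive1 v t
        + invmx v_op *m Dp S *m (g *: eta t + 2^-1 *: vsqr (v t)) = 0].

Definition bbm_bbm_solution (J : set R) (eta v : R -> 'cV[R]_N) : Prop :=
  forall t, J t -> bbm_bbm_solution_at eta v t.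

Definition total_integral u : R := bilin vone (mass S) u.

Definition energy_density eta v : 'cV[R]_N :=
  (2^-1 * g) *: vsqr eta + 2^-1 *: ((eta + depth_vec) ⊙ vsqr v).

Lemma bilin_mass_diag_ge0 (hM : is_diag_mx (mass S)) u :
  0 <= bilin u (mass S *m Kmat) u.
Proof.
have /diag_mxP[d dE] := hM.
have d0 i : 0 <= d 0 i.
  have [_ /(_ (delta_mx i 0))] := mass_posdef S.
  rewrite /bilin dE trmx_delta -rowE mxE (bigD1 i) //= big1 => [|j ji].
    rewrite !mxE !eqxx mulr1n mulr1 addr0 => h; apply/ltW/h.
    by apply/matrix0Pn; exists i, 0; rewrite mxE !eqxx oner_neq0.
  by rewrite !mxE (negPf ji) mulr0.
rewrite /bilin /Kmat dE mulmx_diag mul_mx_diag mxE sumr_ge0 // => i _.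
rewrite !mxE [u i 0 * _]mulrC -mulrA -expr2 mulr_ge0 ?sqr_ge0//.
by rewrite mulr_ge0 ?sqr_ge0.
Qed.

Lemma eta_op_inj (hM : is_diag_mx (mass S)) u : eta_op *m u = 0 -> u = 0.
Proof.
move=> Au0; apply/eqP; apply: contraT => u0.
have [symM /(_ _ u0) Mu] := mass_posdef S.
have skew : mass S *m Dm S = - ((Dp S)^T *m mass S).
  have /(congr1 trmx) := sbp_property S.
  rewrite trmx0 linearD /= !trmx_mul trmxK symM addrC => /eqP.
  by rewrite addr_eq0 => /eqP.
suff : bilin u (mass S *m eta_op) u > 0.
  by rewrite /bilin -!mulmxA Au0 !mulmx0 mxE ltxx.
rewrite /bilin /eta_op mulmxBr mulmx1 -scalemxAr !mulmxA skew.
rewrite !mulNmx scalerN opprK mulmxDr mulmxDl -scalemxAr -scalemxAl mxE [X in _ < _ + X]mxE.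
rewrite ltr_wpDr// mulr_ge0 ?invr_ge0//.
have := bilin_mass_diag_ge0 hM (Dp S *m u).
by rewrite /bilin trmx_mul !mulmxA.
Qed.

Lemma inj_unitmx A : (forall u, A *m u = 0 -> u = 0) -> A \in unitmx.
Proof.
move=> Ainj; rewrite -unitmx_tr -row_free_unit; apply/inj_row_free => w wA.
apply: trmx_inj; rewrite trmx0; apply: Ainj.
by apply: trmx_inj; rewrite trmx_mul trmxK wA trmx0.
Qed.

Lemma eta_op_unit (hM : is_diag_mx (mass S)) : eta_op \in unitmx.
Proof. exact: inj_unitmx (eta_op_inj hM). Qed.

Lemma v_op_unit (hM : is_diag_mx (mass S)) : v_op \in unitmx.
Proof.
apply: inj_unitmx => u.
rewrite /v_op mulmxBl mul1mx => /eqP; rewrite subr_eq0 => /eqP uE.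
suff z0 : Dm S *m Kmat *m u = 0.
  by rewrite uE -scalemxAl -!mulmxA (mulmxA (Dm S)) z0 mulmx0 scaler0.
apply: (eta_op_inj hM); rewrite /eta_op mulmxBl mul1mx [in X in X - _]uE.
by rewrite -!scalemxAl -scalemxAr !mulmxA subrr.
Qed.

End Scheme.
End Defs.

(* Main.v *)
(** Put [A = eta_op], [B = v_op], [e = g eta + v^2/2] and [q = (D + eta) v].
    Since [M] and [K] are diagonal and [M Dm = - Dp^T M], the matrix [M A] is
    symmetric, and [B Dp = Dp A] gives [B^-1 Dp = Dp A^-1]; hence
    [(M A^-1 Dm)^T = - M B^-1 Dp].  The chain rule gives
    [dE/dt = e^T M eta_t + q^T M v_t], where the two terms therefore cancel.
    The linear invariants follow in the same way from [Dp 1 = Dm 1 = 0]. *)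
Require Import Defs.
From HB Require Import structures.
From mathcomp Require Import all_boot all_order all_algebra.
From mathcomp Require Import all_classical all_reals all_analysis.
From mathcomp Require Import ring.
Import Order.TTheory GRing.Theory Num.Theory.
Import numFieldNormedType.Exports.
Local Open Scope classical_set_scope.
Local Open Scope ring_scope.

Lemma is_derive_mxP (R : realFieldType) (V : normedModType R) (m n : nat)
    (F : V -> 'M[R]_(m, n)) (F' : 'M[R]_(m, n)) (x v : V) :
  is_derive x v F F' <->
  forall i j, is_derive x v (fun s => F s i j) (F' i j).
Proof.
split=> [[Fd <-] i j|Fij].
  split; first exact: (derivable_mxP _ _ _).1 Fd i j.
  by rewrite derive_mx// mxE.
have Fd : derivable F x v by apply/derivable_mxP => i j; case: (Fij i j).
split=> //; rewrite derive_mx//; apply/matrixP => i j; rewrite mxE.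
by case: (Fij i j).
Qed.

Lemma is_derive_bilin (R : realType) (N : nat) (u : 'cV[R]_N) (A : 'M[R]_N)
    (F : R -> 'cV[R]_N) (F' : 'cV[R]_N) (t : R) :
  is_derive t 1 F F' -> is_derive t 1 (fun s => bilin u A (F s)) (bilin u A F').
Proof.
move=> /is_derive_mxP dF.
have -> : (fun s => bilin u A (F s)) =
    \sum_(j < N) (u^T *m A) 0 j \*: (fun s => F s j 0).
  by apply/funext => s; rewrite /bilin mxE fct_sumE.
rewrite /bilin mxE; exact: is_derive_sum.
Qed.

Lemma bilin_tr (R : realType) (N : nat) (u v : 'cV[R]_N) (A : 'M[R]_N) :
  bilin u A v = bilin v A^T u.
Proof. by rewrite /bilin -[u^T *m A *m v]trmxK [LHS]mxE !trmx_mul trmxK mulmxA. Qed.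

Lemma bilinMr (R : realType) (N : nat) (u v : 'cV[R]_N) (A B : 'M[R]_N) :
  bilin u A (B *m v) = bilin u (A *m B) v.
Proof. by rewrite /bilin !mulmxA. Qed.

Lemma bilinNr (R : realType) (N : nat) (u v : 'cV[R]_N) (A : 'M[R]_N) :
  bilin u A (- v) = - bilin u A v.
Proof. by rewrite /bilin mulmxN mxE. Qed.

Lemma bilinDr (R : realType) (N : nat) (u v w : 'cV[R]_N) (A : 'M[R]_N) :
  bilin u A (v + w) = bilin u A v + bilin u A w.
Proof. by rewrite /bilin mulmxDr mxE. Qed.

(** For diagonal [A] both sides are a weighted sum of the [u_i v_i]. This turns the discrete
    integral of a product into an inner product, to which transposition applies. *)
Lemma bilin_vone_hadamard (R : realType) (N : nat) (u v : 'cV[R]_N)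
    (A : 'M[R]_N) :
  is_diag_mx A -> bilin (vone R N) A (u ⊙ v) = bilin u A v.
Proof.
move=> /diag_mxP[d ->]; rewrite /bilin !mul_mx_diag !mxE.
by apply: eq_bigr => i _; rewrite !mxE; ring.
Qed.

Section Operator.
Context {R : realType} {N : nat} (S : periodic_upwind_sbp R N).
Hypothesis mass_diag : is_diag_mx (mass S).
Variable depth : R -> R.

Local Notation M := (mass S).
Local Notation K := (Kmat S depth).
Local Notation A := (eta_op S depth).
Local Notation B := (v_op S depth).

Lemma mass_sym : M^T = M.
Proof. by case: (mass_posdef S). Qed.

Lemma mass_Dm : M *m Dm S = - ((Dp S)^T *m M).
Proof.
have /(congr1 trmx) := sbp_property S.
rewrite trmx0 linearD /= !trmx_mul trmxK mass_sym addrC => /eqP.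
by rewrite addr_eq0 => /eqP.
Qed.

Lemma mass_Dp : M *m Dp S = - ((Dm S)^T *m M).
Proof. by apply/eqP; rewrite -addr_eq0 sbp_property. Qed.

(** Summation by parts turns [M *m A] into [M + 1/6 Dp^T M K Dp], which is symmetric because the
    diagonal matrices [M] and [K] commute. *)
Lemma trmx_mass_eta_op : (M *m A)^T = M *m A.
Proof.
have MKC : K *m M = M *m K.
  by have /diag_mxP[d ->] := mass_diag; rewrite /Kmat diag_mxC.
rewrite /eta_op mulmxBr mulmx1 -scalemxAr !mulmxA mass_Dm !mulNmx scalerN opprK.
rewrite linearD linearZ /= !trmx_mul trmxK mass_sym tr_diag_mx.
by rewrite -/K (mulmxA K) MKC !mulmxA.
Qed.

Lemma trmx_mass_inv_eta_op : (M *m invmx A)^T = M *m invmx A.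
Proof.
have uA := eta_op_unit depth mass_diag.
have uAT : A^T \in unitmx by rewrite unitmx_tr.
(* Insert [A A^-1] on the right of [A^-T M]; then [M A = A^T M] cancels [A^-T]. *)
rewrite trmx_mul mass_sym trmx_inv -[LHS](mulmxK uA) -(mulmxA _ M A).
by rewrite -trmx_mass_eta_op trmx_mul mass_sym mulKmx.
Qed.

Lemma inv_v_op_Dp : invmx B *m Dp S = Dp S *m invmx A.
Proof.
have uA := eta_op_unit depth mass_diag.
have uB := v_op_unit depth mass_diag.
(* Both products expand to [Dp - 1/6 Dp Dm K Dp]. *)
have BD : B *m Dp S = Dp S *m A.
  rewrite /v_op /eta_op mulmxBl mulmxBr mul1mx mulmx1.
  by rewrite -scalemxAl -scalemxAr !mulmxA.
by rewrite -[LHS](mulmxK uA) -(mulmxA _ _ A) -BD mulKmx.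
Qed.

Lemma trmx_mass_inv_eta_op_Dm :
  (M *m (invmx A *m Dm S))^T = - (M *m (invmx B *m Dp S)).
Proof.
rewrite inv_v_op_Dp !mulmxA trmx_mul trmx_mass_inv_eta_op.
by rewrite mass_Dp mulNmx opprK mulmxA.
Qed.

(** Once [Dp] stands next to [M], summation by parts gives [1^T M Dp = -(Dm 1)^T M], which vanishes
    by consistency. *)
Lemma vone_mass_inv_v_op_Dp : (vone R N)^T *m (M *m (invmx B *m Dp S)) = 0.
Proof.
rewrite inv_v_op_Dp (mulmxA M) mass_Dp mulNmx mulmxN -mulmxA mulmxA -trmx_mul.
by rewrite (Dm_consistent S) trmx0 mul0mx oppr0.
Qed.

Lemma vone_mass_inv_eta_op_Dm : (vone R N)^T *m (M *m (invmx A *m Dm S)) = 0.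
Proof.
apply: trmx_inj; rewrite trmx_mul trmxK trmx_mass_inv_eta_op_Dm trmx0.
rewrite mulNmx -!mulmxA (Dp_consistent S) !mulmx0.
by rewrite oppr0.
Qed.

(** The factors of [eta'] and [v'] are the partial derivatives of the energy density; each is the
    flux in the evolution equation of the other unknown. *)
Lemma is_derive_energy_density (g t : R) (eta v : R -> 'cV[R]_N)
    (eta' v' : 'cV[R]_N) :
  is_derive t 1 eta eta' -> is_derive t 1 v v' ->
  is_derive t 1 (fun s => energy_density S g depth (eta s) (v s))
    ((g *: eta t + 2^-1 *: vsqr (v t)) ⊙ eta' +
     (depth_vec S depth ⊙ v t + eta t ⊙ v t) ⊙ v').
Proof.
move=> /is_derive_mxP deta /is_derive_mxP dv; apply/is_derive_mxP => i j.
have := deta i j; have := dv i j.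
set e := fun s => eta s i j; set w := fun s => v s i j => dw de.
set d := depth_vec S depth i j.
(* An expression in the ring of functions lets the [is_derive] instances supply the derivative,
   leaving an algebraic identity. *)
have -> : (fun s => energy_density S g depth (eta s) (v s) i j) =
    (2^-1 * g) \*: e ^+ 2 + 2^-1 \*: ((e + cst d) * w ^+ 2).
  by apply/funext => s; rewrite /energy_density !mxE !fctE /d mxE.
apply: is_derive_eq.
rewrite /d !mxE -/(e t) -/(w t) /= /GRing.scale /= !fctE /=.
by field.
Qed.

End Operator.

Theorem theorem3p9 (R : realType) (N : nat) (S : periodic_upwind_sbp R N)
    (mass_diag : is_diag_mx (mass S)) (g : R) (g_gt0 : 0 < g)
    (depth : R -> R) :
  (forall (J : set R) (eta v : R -> 'cV[R]_N),
     open J -> is_interval J -> bbm_bbm_solution S g depth J eta v ->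
     forall t : R, J t ->
       [/\ is_derive t 1 (fun s => total_integral S (eta s)) 0,
           is_derive t 1 (fun s => total_integral S (v s)) 0
         & is_derive t 1
             (fun s => total_integral S
                         (energy_density S g depth (eta s) (v s))) 0])
  /\
  (forall c : R,
     bbm_bbm_solution S g depth setT
       (fun=> c *: vone R N) (fun=> 0)).
Proof.
split=> [J eta v _ _ sol t Jt|c t _]; last first.
  split; rewrite ?derive1_cst; [exact: derivable_cst|exact: derivable_cst|..].
    have -> : depth_vec S depth ⊙ 0 + (c *: vone R N) ⊙ 0 = 0.
      by apply/matrixP => i j; rewrite !mxE !mulr0 addr0.
    by rewrite mulmx0 addr0.
  have -> : vsqr (0 : 'cV[R]_N) = 0.
    by apply/matrixP => i j; rewrite !mxE expr0n.
  (* Only the flux [g c 1] is left, and [Dp] annihilates constants. *)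
  rewrite scaler0 addr0 add0r -!scalemxAr -mulmxA (Dp_consistent S).
  by rewrite mulmx0 !scaler0.
have [deta dv /eqP etaE /eqP vE] := sol t Jt.
move: etaE vE; rewrite !derive1E !addr_eq0 => /eqP etaE /eqP vE.
have {}deta := DeriveDef deta etaE.
have {}dv := DeriveDef dv vE.
split.
- apply: (is_derive_eq (is_derive_bilin _ _ _ _ _ _ _ deta)).
  by rewrite bilinNr bilinMr /bilin vone_mass_inv_eta_op_Dm// mul0mx mxE oppr0.
- apply: (is_derive_eq (is_derive_bilin _ _ _ _ _ _ _ dv)).
  by rewrite bilinNr bilinMr /bilin vone_mass_inv_v_op_Dp// mul0mx mxE oppr0.
- have dE := is_derive_energy_density S depth g _ _ _ _ _ deta dv.
  apply: (is_derive_eq (is_derive_bilin _ _ _ _ _ _ _ dE)).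
  rewrite bilinDr !bilin_vone_hadamard// !bilinNr !bilinMr.
  (* Only the [eta] term is transposed: it becomes the [v] term with opposite sign. *)
  rewrite [X in - X - _]bilin_tr trmx_mass_inv_eta_op_Dm//.
  by rewrite /bilin mulmxN mulNmx mxE opprK subrr.
Qed.
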